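(* Let $n$ be a positive integer, let $\mathcal{PT}_n$ be the set of permutation tableaux of length $n$, and let $c(\mathcal{PT}_n)=\sum_{P\in\mathcal{PT}_n}c(P)$, where $c(P)$ is the number of corners of $P$. Then $$c(\mathcal{PT}_n)=\begin{cases}0,&\text{if } n=1,\\ (n-1)!\times\dfrac{n^2+4n-6}{6},&\text{if } n\geq 2.\end{cases}$$
   Context: For nonnegative integers $n\geq k$, a $(k,n)$-diagram is a left-justified diagram of boxes (cells) inside a $k\times(n-k)$ rectangle with $\lambda_i$ boxes in the $i$-th row, where $\lambda_1\geq\lambda_2\geq\cdots\geq\lambda_k\geq 0$ (empty rows and empty columns are allowed). Its length is $n$, the number of rows plus the number of columns. A cell is a corner of the diagram if its bottom and right edges both lie on the southeast border of the diagram, i.e. there is no cell of the diagram immediately to its right and none immediately below it. The corners of a tableau are the corners of its underlying diagram, and the length of a tableau is the length of its underlying diagram. A permutation tableau is a $(k,n)$-diagram with no empty columns (empty rows are allowed), together with a filling of its cells with $0$s and $1$s such that: (1) each column has at least one $1$; (2) there is no $0$ which has both a $1$ above it in the same column and a $1$ to its left in the same row. *)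

(* Defs.v *)
From HB Require Import structures.
From mathcomp Require Import all_boot all_order all_algebra.

Set Implicit Arguments.
Unset Strict Implicit.
Unset Printing Implicit Defensive.

(* Rows are numbered from 0 top to bottom, columns from 0 left to right.      *)

(* The number of columns is n - k, a truncated subtraction: diagram k n is    *)
(* only meaningful for k <= n, which the index type 'I_n.+1 below enforces.   *)
Record diagram (k n : nat) := Diagram {
  row_length :> {ffun 'I_k -> 'I_(n - k).+1};
  _ : [forall i : 'I_k, forall j : 'I_k,
         (i <= j) ==> (row_length j <= row_length i)]
}.

HB.instance Definition _ (k n : nat) := [isSub for @row_length k n].
HB.instance Definition _ (k n : nat) := [Finite of diagram k n by <:].

Definition in_diagram (k n : nat) (D : diagram k n) (p : 'I_k * 'I_(n - k)) :
  bool := p.2 < D p.1.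

Record cell (k n : nat) (D : diagram k n) := Cell {
  cell_pos :> 'I_k * 'I_(n - k);
  _ : in_diagram D cell_pos
}.

HB.instance Definition _ (k n : nat) (D : diagram k n) :=
  [isSub for @cell_pos k n D].
HB.instance Definition _ (k n : nat) (D : diagram k n) :=
  [Finite of cell D by <:].

Section Tableaux.
Variables (k n : nat) (D : diagram k n).
Local Notation cell := (cell D).

Definition cell_row (c : cell) : 'I_k := (cell_pos c).1.
Definition cell_col (c : cell) : 'I_(n - k) := (cell_pos c).2.

(* right_of c d, below c d: d is the cell immediately to the right of, resp.  *)
(* immediately below, c.                                                      *)
Definition right_of (c d : cell) : bool :=
  (cell_row d == cell_row c) && (cell_col d == (cell_col c).+1 :> nat).

Definition below (c d : cell) : bool :=
  (cell_col d == cell_col c) && (cell_row d == (cell_row c).+1 :> nat).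

Definition corner (c : cell) : bool :=
  ~~ [exists d : cell, right_of c d] && ~~ [exists d : cell, below c d].

Definition no_empty_column : bool :=
  [forall j : 'I_(n - k), exists c : cell, cell_col c == j].

(* A filling maps a cell to true for the entry 1 and to false for 0. *)
Definition filling := {ffun cell -> bool}.

Definition column_has_one (F : filling) : bool :=
  [forall j : 'I_(n - k), exists c : cell, (cell_col c == j) && F c].

Definition one_above (F : filling) (c : cell) : bool :=
  [exists u : cell,
     [&& cell_col u == cell_col c, cell_row u < cell_row c & F u]].

Definition one_left (F : filling) (c : cell) : bool :=
  [exists l : cell,
     [&& cell_row l == cell_row c, cell_col l < cell_col c & F l]].

Definition no_forbidden_zero (F : filling) : bool :=
  ~~ [exists c : cell, [&& ~~ F c, one_above F c & one_left F c]].

Definition is_permutation_tableau (F : filling) : bool :=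
  [&& no_empty_column, column_has_one F & no_forbidden_zero F].

Definition nb_corners : nat := #|[set c : cell | corner c]|.

End Tableaux.

(* All fillings of diagrams of length n: a number k <= n of rows, a           *)
(* (k, n)-diagram and a filling of its cells.                                 *)
Definition filled_diagram (n : nat) :=
  {k : 'I_n.+1 & {D : diagram k n & filling D}}.

Definition underlying (n : nat) (P : filled_diagram n) : diagram (tag P) n :=
  tag (tagged P).

Definition entries (n : nat) (P : filled_diagram n) : filling (underlying P) :=
  tagged (tagged P).

Definition permutation_tableaux (n : nat) : {set filled_diagram n} :=
  [set P : filled_diagram n | is_permutation_tableau (entries P)].

Definition corners (n : nat) (P : filled_diagram n) : nat :=
  nb_corners (underlying P).

Definition total_corners (n : nat) : nat :=
  \sum_(P in permutation_tableaux n) corners P.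

(* Main.v *)
Require Import Defs.
From mathcomp Require Import all_boot all_order all_algebra.
From mathcomp Require Import ring zify.

(** Read the southeast border of a permutation tableau from its northeast to
    its southwest end: a south step is a row, a west step is a column, and a
    corner is a south step followed by a west step.  Appending a south step adds
    an empty row; appending a west step adds a full column on the left.  Call a
    row unrestricted if it has no 0 below a 1.  The new column must be 0 in all
    restricted rows, and in the [u] unrestricted ones it is any nonzero 0/1
    vector.  With [y] marking unrestricted rows, a south step acts by
    [y^u -> y * y^u] and a west step by [y^u -> y * ((y + 1)^u - y^u)], so one
    arbitrary step sends [f y] to [y * f (y + 1)].  Hence tableaux of length [t]
    have generating function [y (y + 1) ... (y + t - 1)], and corners satisfy a
    linear recurrence in [t] with an explicit solution, evaluated at [y = 1]. *)

Set Implicit Arguments.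
Unset Strict Implicit.
Unset Printing Implicit Defensive.

(** * Tableaux as sequences of border steps *)

(* A history lists the border steps, latest first: [None] is a row, and         *)
(* [Some T] is a column with ones exactly in the rows of [T].  A row is named   *)
(* by the position of its border step, counted from 0 at the northeast.         *)

Section Histories.
Variable N : nat.
Local Notation step := (option {set 'I_N}).
Implicit Types (T U : {set 'I_N}) (l : seq step) (r c : 'I_N).

(* The rows of [U] that stay unrestricted when a column with set of ones [T] is *)
(* added.                                                                       *)
Definition survivors T U : {set 'I_N} :=
  [set r in U | (r \in T) || [forall s in T, r <= s]].

Fixpoint unrestricted l : {set 'I_N} :=
  match l with
  | [::] => set0
  | None :: l' => [set r : 'I_N | r == size l' :> nat] :|: unrestricted l'
  | Some T :: l' => survivors T (unrestricted l')
  end.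

Fixpoint valid l : bool :=
  match l with
  | [::] => true
  | None :: l' => valid l'
  | Some T :: l' => [&& T \subset unrestricted l', T != set0 & valid l']
  end.

(** The default [x] of [head] makes the term vanish when [l'] is empty: a west step that opens the
    border closes no corner. *)
Fixpoint history_corners l : nat :=
  if l is x :: l' then
    (x != None) && (head x l' == None) + history_corners l'
  else 0.

(** [N] stays fixed while [t] varies, so induction on the length never changes the type of the
    labels. *)
Fixpoint histories t : seq (seq step) :=
  if t is t'.+1 then
    [seq None :: l | l <- histories t'] ++
    [seq Some T :: l | l <- histories t',
       T <- enum [pred T : {set 'I_N} | (T \subset unrestricted l) && (T != set0)]]
  else [:: [::]].

Lemma mem_histories t l : (l \in histories t) = (size l == t) && valid l.
Proof.
elim: t l => [|t IH] [|[T|] l] //=; rewrite mem_cat.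
- apply/norP; split; first by apply/mapP=> [[? _]].
  by apply/allpairsPdep=> [[? [? []]]].
- rewrite eqSS andbCA [_ && valid l]andbC !andbA; apply/orP/idP.
  + case=> [/mapP[? _] //|/allpairsPdep[l' [T' []]]].
    rewrite IH mem_enum inE => /andP[sz v] /andP[sU n0] [-> ->].
    by rewrite sz v sU n0.
  + case/andP=> /andP[/andP[sz sU] n0] v.
    right; apply/allpairsPdep; exists l, T.
    by rewrite IH mem_enum inE sz v sU n0.
rewrite eqSS; apply/orP/idP.
  case=> [/mapP[l' ]|/allpairsPdep[? [? []]]] //.
  by rewrite IH => ? [->].
by move=> H; left; apply/mapP; exists l; rewrite ?IH.
Qed.

Lemma histories_uniq t : uniq (histories t).
Proof.
elim: t => //= t IH; rewrite cat_uniq map_inj_uniq ?IH /=; last by move=> ? ? [].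
apply/andP; split.
  apply/hasPn=> x /allpairsPdep[l [T [_ _ ->]]].
  by apply/mapP=> [[]].
apply: allpairs_uniq_dep => //.
  by move=> l _; rewrite enum_uniq.
by move=> [l T] [l' T'] _ _ /= [-> ->].
Qed.

(** * Generating functions and their recurrences *)

Import GRing.Theory.
Local Open Scope ring_scope.

Lemma sum_histoS (V : nmodType) (f : seq step -> V) t :
  \sum_(l <- histories t.+1) f l =
  \sum_(l <- histories t) (f (None :: l) +
     \sum_(T : {set 'I_N} | (T \subset unrestricted l) && (T != set0)) f (Some T :: l)).
Proof.
rewrite /= big_cat big_map big_allpairs_dep big_split /=; congr (_ + _).
by apply: eq_bigr => l _; rewrite big_enum.
Qed.

Variable R : comPzRingType.
Implicit Types y : R.

(* By induction on [U], splitting on whether its bottom row belongs to [T].     *)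
Lemma sum_survivors y U :
  \sum_(T : {set 'I_N} | (T \subset U) && (T != set0)) y ^+ #|survivors T U| =
  y * ((y + 1) ^+ #|U| - y ^+ #|U|).
Proof.
move: {2}#|U| (erefl #|U|) => u.
elim: u U => [|u IH] U cU.
  move/cards0_eq: cU ->; rewrite cards0 !expr0 subrr mulr0 big1 // => T.
  by rewrite subset0 andbN.
have [a0 a0U] : exists a, a \in U by apply/set0Pn; rewrite -card_gt0 cU.
pose a := [arg max_(i > a0 in U) (i : nat)].
have [aU amax] : a \in U /\ forall r, r \in U -> (r <= a)%N.
  by rewrite /a; case: arg_maxnP => // i iU H; split.
pose U' := U :\ a.
have cU' : #|U'| = u by move: (cardsD1 a U); rewrite aU cU /U' => -[].
have lta r : r \in U' -> (r < a)%N.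
  by rewrite !inE => /andP[ne /amax]; rewrite leq_eqVlt val_eqE (negbTE ne).
have aU' : a \notin U' by rewrite !inE eqxx.
rewrite (bigID (fun T => a \in T)) /=.
rewrite (reindex_onto (fun T => a |: T) (fun T => T :\ a)) /=; last first.
  by move=> T /andP[_ aS]; rewrite setD1K.
(* Row [a] is below all others, so a 1 there restricts none of them; [a] itself survives and gives
   the factor [y]. *)
have E1 : \sum_(T : {set 'I_N} | ((a |: T \subset U) && (a |: T != set0) && (a \in a |: T))
               && ((a |: T) :\ a == T)) y ^+ #|survivors (a |: T) U| =
   y * \sum_(T : {set 'I_N} | T \subset U') y ^+ #|survivors T U'|.
  rewrite mulr_sumr; apply: eq_big => [T|T].
    rewrite setU11 andbT subUset sub1set aU /= subsetD1.
    have -> : a |: T != set0 by apply/set0Pn; exists a; rewrite setU11.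
    rewrite andbT; congr (_ && _).
    apply/eqP/idP=> [<-|aS]; first by rewrite !inE eqxx.
    by rewrite setU1K.
  move=> /andP[_ /eqP eS].
  have aS : a \notin T by rewrite -eS !inE eqxx.
  rewrite -exprS; congr (_ ^+ _).
  have -> : survivors (a |: T) U = a |: survivors T U'.
    apply/setP=> r; rewrite !inE.
    have [->|ne] /= := eqVneq r a; first by rewrite aU.
    have [rU|//] /= := boolP (r \in U); congr (_ || _).
    apply/forall_inP/forall_inP=> H s sS; first by apply: H; rewrite inE sS orbT.
    move: sS; rewrite !inE => /orP[/eqP ->|]; last exact: H.
    exact: amax.
  by rewrite cardsU1 !inE eqxx.
rewrite {}E1.
(* Without a 1 in row [a], its 0 lies below a 1 of [T], so [a] becomes restricted. *)
have -> : \sum_(T : {set 'I_N} | (T \subset U) && (T != set0) && (a \notin T))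
             y ^+ #|survivors T U| =
   \sum_(T : {set 'I_N} | (T \subset U') && (T != set0)) y ^+ #|survivors T U'|.
  apply: eq_big => [T|T /andP[/andP[sU n0] aS]].
    by rewrite andbAC -subsetD1.
  congr (_ ^+ #|pred_of_set _|); apply/setP=> r; rewrite !inE.
  have [->|//] := eqVneq r a; rewrite aU (negbTE aS) /=.
  have [s sS] := set0Pn _ n0.
  apply/negbTE/forall_inPn; exists s => //; rewrite -ltnNge lta // !inE.
  by rewrite (subsetP sU) // andbT; apply: contraNneq aS => <-.
(* [T = set0] occurs only in the first sum; the rest of both sums is the induction hypothesis. *)
rewrite (bigD1 set0) ?sub0set //= IH // cU' cU.
have -> : survivors set0 U' = U'.
  apply/setP=> r; rewrite !inE.
  by have -> : [forall s in (set0 : {set 'I_N}), (r <= s)%N]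
    by [apply/forall_inP=> s; rewrite inE]; rewrite andbT.
by rewrite cU' !exprS; ring.
Qed.

Definition history_gf t y : R := \sum_(l <- histories t) y ^+ #|unrestricted l|.
Definition corner_gf t y : R :=
  \sum_(l <- histories t) (history_corners l)%:R * y ^+ #|unrestricted l|.

Lemma unrestricted_lt l r : r \in unrestricted l -> (r < size l)%N.
Proof.
elim: l => [|[T|] l IH] /=; rewrite !inE //.
  by move=> /andP[/IH/ltnW].
by case/orP=> [/eqP ->//|/IH/ltnW].
Qed.

Lemma card_unrestricted_None l : (size l < N)%N ->
  #|unrestricted (None :: l)| = #|unrestricted l|.+1.
Proof.
move=> lN /=; have -> : [set r : 'I_N | r == size l :> nat] = [set Ordinal lN].
  by apply/setP=> r; rewrite !inE.
rewrite cardsU1; case: (boolP (_ \in _)) => //.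
by move/unrestricted_lt; rewrite ltnn.
Qed.

Lemma history_gfS t y : (t < N)%N ->
  history_gf t.+1 y = y * history_gf t (y + 1).
Proof.
move=> tN; rewrite /history_gf sum_histoS mulr_sumr.
rewrite big_seq [RHS]big_seq; apply: eq_bigr => l.
rewrite mem_histories => /andP[/eqP sz _].
by rewrite card_unrestricted_None ?sz // sum_survivors exprS; ring.
Qed.

Lemma history_gfE t y : (t <= N)%N ->
  history_gf t y = \prod_(i < t) (y + i%:R).
Proof.
elim: t y => [|t IH] y tN.
  by rewrite /history_gf big_ord0 big_seq1 cards0.
rewrite history_gfS // IH ?(ltnW tN) // big_ord_recl addr0; congr (_ * _).
by apply: eq_bigr => i _; rewrite -addrA -natr1 [1 + _]addrC.
Qed.

Lemma corner_gf1 y : corner_gf 1 y = 0.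
Proof.
rewrite /corner_gf sum_histoS big_seq1 mul0r add0r big1 // => T.
by rewrite subset0 andbN.
Qed.

(** Earlier corners are carried along by the operator of [history_gfS]. A new corner arises when the
    last two steps are a row and then a column; from [u] unrestricted rows these yield
    [y * ((y + 1) ^+ u.+1 - y ^+ u.+1)]. *)
Lemma corner_gfSS t y : (t.+1 < N)%N ->
  corner_gf t.+2 y = y * corner_gf t.+1 (y + 1) +
    y * ((y + 1) * history_gf t (y + 1) - y * history_gf t y).
Proof.
move=> tN; rewrite {1}/corner_gf sum_histoS.
(* [b l] tells whether a west step after [l] closes a corner; the default is not [None], so an empty
   [l] gives 0. *)
pose b l : R := (head (Some set0) l == None)%:R.
transitivity (y * corner_gf t.+1 (y + 1) + \sum_(l <- histories t.+1)
    b l * (y * ((y + 1) ^+ #|unrestricted l| - y ^+ #|unrestricted l|))).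
  rewrite /corner_gf mulr_sumr -big_split.
  rewrite big_seq [RHS]big_seq; apply: eq_bigr => l.
  rewrite mem_histories => /andP[/eqP sz _].
  rewrite card_unrestricted_None ?sz //=.
  have -> : \sum_(T : {set 'I_N} | (T \subset unrestricted l) && (T != set0))
       ((Some T != None) && (head (Some T) l == None) + history_corners l)%:R *
       y ^+ #|survivors T (unrestricted l)| =
     (b l + (history_corners l)%:R) *
     \sum_(T : {set 'I_N} | (T \subset unrestricted l) && (T != set0))
         y ^+ #|survivors T (unrestricted l)|.
    rewrite mulr_sumr; apply: eq_bigr => T _; rewrite natrD.
    by rewrite /b; case: (l).
  by rewrite sum_survivors exprS add0n; ring.
congr (_ + _); rewrite sum_histoS /history_gf !mulr_sumr -sumrB mulr_sumr.
rewrite big_seq [RHS]big_seq; apply: eq_bigr => l.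
rewrite mem_histories => /andP[/eqP sz _].
rewrite [X in _ + X]big1 ?addr0; last by move=> T _; rewrite /b /= mul0r.
by rewrite card_unrestricted_None ?sz 1?ltnW // /b /= mul1r !exprS.
Qed.

End Histories.

(** * Labelling rows and columns by border steps *)

Lemma card_ltn_ord k a : a <= k -> #|[set i : 'I_k | i < a]| = a.
Proof.
move=> ak; have inj_widen : injective (widen_ord ak).
  by move=> i j /(congr1 val)/= /val_inj.
rewrite -[RHS]card_ord -(card_imset predT inj_widen).
apply: eq_card => i; rewrite inE; apply/idP/imsetP => [ia|[j _ ->]].
  by exists (Ordinal ia) => //; apply: val_inj.
by rewrite /= ltn_ord.
Qed.

Section BorderLabels.
Variables (k n : nat) (D : diagram k n).
Hypothesis kn : k <= n.

Lemma row_length_decr (i i' : 'I_k) : i <= i' -> D i' <= D i.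
Proof. by case: D => f /= /forallP/(_ i)/forallP/(_ i')/implyP. Qed.

Definition col_height (j : 'I_(n - k)) : nat := #|[set i : 'I_k | j < D i]|.

(** Conjugation of partitions: row lengths weakly decrease, so the rows reaching column [j] form an
    initial segment. *)
Lemma ltn_col_height (i : 'I_k) j : (i < col_height j) = (j < D i).
Proof.
apply/idP/idP.
  apply: contraLR; rewrite -!leqNgt => Dj.
  rewrite -(card_ltn_ord (ltnW (ltn_ord i))); apply: subset_leq_card.
  apply/subsetP => i'; rewrite !inE => ji'; rewrite ltnNge; apply/negP => ii'.
  by have := leq_trans ji' (leq_trans (row_length_decr ii') Dj); rewrite ltnn.
move=> ji; rewrite -[i.+1](card_ltn_ord (ltn_ord i)); apply: subset_leq_card.
apply/subsetP => i'; rewrite !inE ltnS => ii'.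
exact: leq_trans ji (row_length_decr ii').
Qed.

Lemma col_height_le j : col_height j <= k.
Proof. by rewrite -[X in _ <= X]card_ord max_card. Qed.

Lemma col_height_decr (j j' : 'I_(n - k)) : j <= j' -> col_height j' <= col_height j.
Proof.
move=> jj'; apply: subset_leq_card; apply/subsetP => i; rewrite !inE.
exact: leq_ltn_trans.
Qed.

(* The label of a row or column is the number of border steps before its own,   *)
(* counting from the northeast end.                                             *)
Lemma row_label_subproof (i : 'I_k) : i + (n - k - D i) < n.
Proof. by have := ltn_ord i; lia. Qed.
Definition row_label i : 'I_n := Ordinal (row_label_subproof i).

Lemma col_label_subproof (j : 'I_(n - k)) : n - k - j.+1 + col_height j < n.
Proof. by have := ltn_ord j; have := col_height_le j; lia. Qed.
Definition col_label j : 'I_n := Ordinal (col_label_subproof j).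

Lemma row_length_le (i : 'I_k) : D i <= n - k.
Proof. by rewrite -ltnS. Qed.

Lemma row_label_ltn (i i' : 'I_k) : (row_label i < row_label i') = (i < i').
Proof.
have lei (a b : 'I_k) : a <= b -> row_label a <= row_label b.
  move=> ab /=; have := row_length_decr ab; have := row_length_le a; lia.
have lti (a b : 'I_k) : a < b -> row_label a < row_label b.
  move=> ab /=; have := row_length_decr (ltnW ab); have := row_length_le a; lia.
case: (leqP i' i) => [/lei|/lti ->//].
by rewrite leqNgt => /negbTE.
Qed.

Lemma row_label_inj : injective row_label.
Proof.
move=> i i' e; apply: val_inj; have := row_label_ltn i i'; have := row_label_ltn i' i.
by rewrite e ltnn /=; case: ltngtP.
Qed.

(** The border meets the columns from right to left, which reverses the order. *)
Lemma col_label_ltn (j j' : 'I_(n - k)) :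
  (col_label j' < col_label j) = (j < j').
Proof.
have lei (a b : 'I_(n - k)) : a <= b -> col_label b <= col_label a.
  by move=> ab /=; have := col_height_decr ab; lia.
have lti (a b : 'I_(n - k)) : a < b -> col_label b < col_label a.
  move=> ab /=; have := col_height_decr (ltnW ab); have := ltn_ord b; lia.
case: (leqP j' j) => [/lei|/lti ->//].
by rewrite leqNgt => /negbTE.
Qed.

Lemma col_label_inj : injective col_label.
Proof.
move=> i i' e; apply: val_inj; have := col_label_ltn i i'; have := col_label_ltn i' i.
by rewrite e ltnn /=; case: ltngtP.
Qed.

(** Turns membership in the diagram into an order of labels. If [j < D i], then [i < col_height j]
    and [n - k - D i <= n - k - j.+1]; otherwise both inequalities are reversed. *)
Lemma ltn_row_col_label i j : (row_label i < col_label j) = (j < D i).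
Proof.
have := ltn_col_height i j; have := ltn_ord j; have := row_length_le i => /=.
case: (ltnP j (D i)); case: (ltnP i (col_height j)); lia.
Qed.

Lemma row_col_label_neq i j : row_label i != col_label j.
Proof.
rewrite -val_eqE /=.
have := ltn_col_height i j; have := ltn_ord j; have := row_length_le i => /=.
case: (ltnP j (D i)); case: (ltnP i (col_height j)); lia.
Qed.

(** By counting: the labels are distinct and there are [k + (n - k) = n] of them. *)
Lemma labels_cover (t : 'I_n) :
  (exists i, t = row_label i) \/ (exists j, t = col_label j).
Proof.
pose A := [set row_label i | i in 'I_k]; pose B := [set col_label j | j in 'I_(n - k)].
have AB0 : A :&: B = set0.
  apply/setP => x; rewrite !inE; apply/andP => -[/imsetP[i _ ->] /imsetP[j _ e]].
  by have := row_col_label_neq i j; rewrite e eqxx.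
have : A :|: B == setT.
  rewrite eqEcard subsetT cardsT card_ord cardsU AB0 cards0 subn0.
  rewrite !card_imset; [|exact: col_label_inj|exact: row_label_inj].
  by rewrite !card_ord subnKC /=.
move/eqP/setP/(_ t); rewrite !inE => /orP[] /imsetP[x _ ->]; [left|right]; by exists x.
Qed.

Lemma cell_labels (c : cell D) : row_label (cell_row c) < col_label (cell_col c).
Proof. by rewrite ltn_row_col_label; case: c => p. Qed.

Lemma cell_of_labels (i : 'I_k) (j : 'I_(n - k)) : row_label i < col_label j ->
  exists c : cell D, cell_row c = i /\ cell_col c = j.
Proof.
rewrite ltn_row_col_label => H.
by exists (@Cell _ _ D (i, j) H).
Qed.

Lemma cell_inj (c c' : cell D) : cell_row c = cell_row c' ->
  cell_col c = cell_col c' -> c = c'.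
Proof.
case: c c' => -[i j] ci [[i' j'] ci'] e1 e2; apply: val_inj.
by rewrite /= (e1 : i = i') (e2 : j = j').
Qed.

(** The column label minus the row label is the hook length of the cell, and corners are the cells
    of hook length 1. *)
Lemma cornerE (c : cell D) :
  corner c = (col_label (cell_col c) == (row_label (cell_row c)).+1 :> nat).
Proof.
set i := cell_row c; set j := cell_col c.
have ji : j < D i by rewrite /i /j; case: (c).
have ij : i < col_height j by rewrite ltn_col_height.
rewrite /corner; have -> : [exists d, right_of c d] = (j.+1 < D i).
  apply/existsP/idP => [[d /andP[/eqP e /eqP e']]|H].
    by rewrite -e' /i -e; case: (d).
  have jn : j.+1 < n - k by apply: leq_trans H (row_length_le i).
  exists (@Cell _ _ D (i, Ordinal jn) H).
  by rewrite /right_of /= !eqxx.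
have -> : [exists d, below c d] = (i.+1 < col_height j).
  apply/existsP/idP => [[d /andP[/eqP e /eqP e']]|H].
    by rewrite -e' ltn_col_height /j -e; case: (d).
  have ik : i.+1 < k by apply: leq_trans H (col_height_le j).
  have Hc : in_diagram D (Ordinal ik, j) by rewrite /in_diagram /= -ltn_col_height.
  exists (Cell Hc).
  by rewrite /below /= !eqxx.
have := ltn_ord j; have := row_length_le i; rewrite /= -!leqNgt; lia.
Qed.

Definition row_labels : {set 'I_n} := [set row_label i | i in 'I_k].

Lemma col_label_notin_rows j : col_label j \notin row_labels.
Proof. by apply/imsetP => -[i _ e]; have := row_col_label_neq i j; rewrite e eqxx. Qed.

Lemma row_label_in_rows i : row_label i \in row_labels.
Proof. exact: imset_f. Qed.

Lemma card_row_labels : #|row_labels| = k.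
Proof. by rewrite card_imset ?card_ord //; exact: row_label_inj. Qed.

Lemma notin_rows t : t \notin row_labels -> exists j, t = col_label j.
Proof.
by case: (labels_cover t) => // -[i ->]; rewrite row_label_in_rows.
Qed.

(** A corner is determined by its column label, since its row label is one less. *)
Lemma nb_cornersE : nb_corners D =
  \sum_(t : 'I_n) ((t \notin row_labels) &&
                   [exists r in row_labels, t == r.+1 :> nat]).
Proof.
rewrite -big_mkcond /= sum1dep_card /nb_corners.
have inj : {in [set c : cell D | corner c] &,
    injective (fun c => col_label (cell_col c))}.
  move=> c c'; rewrite !inE !cornerE => /eqP ec /eqP ec' e.
  apply: cell_inj; last exact: col_label_inj e.
  apply: row_label_inj; apply: val_inj; apply: succn_inj.
  by rewrite -ec -ec' e.
rewrite -(card_in_imset inj); apply: eq_card => t; rewrite !inE.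
apply/imsetP/andP => [[c]|[/notin_rows[j ->] /exists_inP[r /imsetP[i _ ->]]] /eqP e].
  rewrite inE cornerE => H ->; rewrite col_label_notin_rows; split=> //.
  by apply/exists_inP; exists (row_label (cell_row c)); rewrite ?row_label_in_rows.
have [c [ci cj]] : exists c : cell D, cell_row c = i /\ cell_col c = j.
  by apply: cell_of_labels; rewrite e.
by exists c; rewrite ?inE ?cornerE ?ci cj ?e.
Qed.

Lemma row_rank i : #|[set r in row_labels | r < row_label i]| = i.
Proof.
rewrite -[RHS](card_ltn_ord (ltnW (ltn_ord i))) -(card_imset _ row_label_inj).
apply: eq_card => r; rewrite !inE; apply/andP/imsetP.
  move=> [/imsetP[i' _ ->]]; rewrite row_label_ltn => ii'.
  by exists i'; rewrite ?inE.
by move=> [i' ]; rewrite inE => ii' ->; rewrite row_label_in_rows row_label_ltn.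
Qed.

End BorderLabels.

(** By [row_rank] the set determines the label of row [i], and this label together with [i] gives
    back the row length. *)
Lemma row_labels_inj k n (kn : k <= n) : injective (@row_labels k n ^~ kn).
Proof.
move=> D D' e; apply/val_inj/ffunP => i; apply/val_inj.
have /imsetP[i' _ ei] : row_label D kn i \in row_labels D' kn.
  by rewrite -e row_label_in_rows.
have ii' : i = i' :> nat.
  by rewrite -(row_rank D kn i) -(row_rank D' kn i') -e -ei.
have := row_length_le D i; have := row_length_le D' i.
have /= := congr1 val ei; rewrite -(val_inj ii'); lia.
Qed.

Lemma row_labels_surj n (A : {set 'I_n}) (kn : #|A| <= n) :
  exists D : diagram #|A| n, row_labels D kn = A.
Proof.
pose rank (t : 'I_n) := #|[set r in A | r < t]|.
have rank_mono (s t : 'I_n) : s <= t -> rank s <= rank t.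
  move=> st; apply: subset_leq_card; apply/subsetP => r; rewrite !inE.
  by case/andP=> -> /leq_trans; apply.
have cardC : #|~: A| = n - #|A| by rewrite cardsCs setCK card_ord.
(* A column lies in row [i] iff its height, the rank of its label, exceeds [i]. *)
have f_subproof (i : 'I_#|A|) : #|[set c in ~: A | i < rank c]| < (n - #|A|).+1.
  by rewrite ltnS -cardC subset_leq_card //; apply/subsetP => c; rewrite inE => /andP[].
pose f := [ffun i => Ordinal (f_subproof i)].
have fP : [forall i : 'I_#|A|, forall j : 'I_#|A|, (i <= j) ==> (f j <= f i)].
  apply/forallP => i; apply/forallP => j; apply/implyP => ij; rewrite !ffunE /=.
  apply: subset_leq_card; apply/subsetP => c; rewrite !inE => /andP[->].
  exact: leq_ltn_trans.
(* Both sets have [#|A|] elements, so it suffices that every [r] in [A] is a row label, namely that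
   of row [rank r]. *)
exists (Diagram fP); apply/esym/eqP; rewrite eqEcard card_row_labels leqnn andbT.
apply/subsetP => r rA.
have ri : rank r < #|A|.
  apply: proper_card; apply/properP; split.
    by apply/subsetP => s; rewrite inE => /andP[].
  by exists r; rewrite ?inE // ltnn andbF.
suff -> : r = row_label (Diagram fP) kn (Ordinal ri) by exact: row_label_in_rows.
apply: val_inj; rewrite /= ffunE /=.
have rankS (c : 'I_n) : r < c -> rank r < rank c.
  move=> rc; apply: proper_card; apply/properP; split.
    by apply/subsetP => s; rewrite !inE => /andP[-> /ltn_trans]; apply.
  by exists r; rewrite !inE ?rA ?rc // ltnn.
have -> : [set c in ~: A | rank r < rank c] = [set c in ~: A | r < c].
  apply/setP => c; rewrite !inE; case: (c \in A) => //=.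
  apply/idP/idP; last exact: rankS.
  by apply: contraLR; rewrite -!leqNgt => /rank_mono.
(* The label of row [rank r] is [rank r] plus the number of west steps not after [r], that is, of
   all steps before [r]. *)
have E1 : #|[set c in ~: A | r < c]| + #|[set c in ~: A | c < r]| = #|~: A|.
  have -> : #|~: A| =
      #|[set c in ~: A | r < c] :|: [set c in ~: A | c < r]|.
    apply: eq_card => c; rewrite !inE.
    case: (ltngtP r c); rewrite ?andbF ?andbT ?orbF //.
    by move/val_inj <-; rewrite rA.
  rewrite -cardsUI -[RHS]addn0; congr addn; apply/eqP; rewrite cards_eq0.
  by apply/eqP/setP => c; rewrite !inE; case: (ltngtP r c); rewrite ?andbF.
have E2 : rank r + #|[set c in ~: A | c < r]| = r.
  rewrite -[RHS](card_ltn_ord (ltnW (ltn_ord r))) /rank -cardsUI.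
  rewrite -[RHS]addn0; congr addn.
    by apply: eq_card => c; rewrite !inE; case: (c \in A); rewrite ?orbF.
  apply/eqP; rewrite cards_eq0; apply/eqP/setP => c.
  by rewrite !inE; case: (c \in A); rewrite ?andbF.
by rewrite -cardC -E1 addKn E2.
Qed.

(** * The history of a tableau *)

Section Steps.
Variable N : nat.
Local Notation step := (option {set 'I_N}).
Implicit Types (T : {set 'I_N}) (l : seq step) (r c : 'I_N).

(** [rev] makes [t] count from the northeast, as the labels do. Past the end the value is [None],
    like a row, so bounds on [t] are stated separately. *)
Definition step_at l (t : nat) : step := nth None (rev l) t.

Lemma step_at_cons x l t :
  step_at (x :: l) t =
  if t < size l then step_at l t else if t == size l then x else None.
Proof. by rewrite /step_at rev_cons nth_rcons size_rev. Qed.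

(** For a row [r], this is being unrestricted just before step [m], without recursion. *)
Definition unblocked l r (m : nat) : Prop :=
  forall c T, r < c -> c < m -> step_at l c = Some T ->
  r \in T \/ forall s : 'I_N, s \in T -> r <= s.

Lemma unblocked_cons x l r m : m <= size l ->
  unblocked (x :: l) r m <-> unblocked l r m.
Proof.
move=> ml; split=> H c T rc cm e; apply: H rc (cm) _.
  by rewrite step_at_cons (leq_trans cm ml).
by rewrite step_at_cons (leq_trans cm ml) in e.
Qed.

Lemma unrestrictedP l r : size l <= N ->
  r \in unrestricted l <->
  [/\ r < size l, step_at l r = None & unblocked l r (size l)].
Proof.
elim: l => [|x l IH] sN; first by rewrite inE; split=> // -[].
have {}IH := IH (ltnW sN); rewrite step_at_cons.
case: x sN => [T|] sN /=; rewrite !inE.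
  split.
    move=> /andP[/IH[rl e ub] H]; rewrite rl ltnW //; split=> // c T' rc cm.
    rewrite step_at_cons; case: ltnP => [cl|lc]; first exact: ub.
    case: eqP => // _ [<-]; case/orP: H => [|/forall_inP]; by [left|right].
  case; rewrite ltnS leq_eqVlt => /orP[/eqP ->|rl].
    by rewrite ltnn eqxx.
  rewrite rl => e ub; apply/andP; split.
    by apply/IH; split=> // c T' rc cl; apply: (unblocked_cons _ _ _).1 rc cl => //
      c' T'' rc' cl'; apply: ub => //; exact: ltnW.
  have [||->//|H] := ub (Ordinal sN) T rl; first by rewrite /= ltnSn.
    by rewrite step_at_cons /= ltnn eqxx.
  by apply/orP; right; apply/forall_inP.
split.
  case/orP=> [/eqP rl|/IH[rl e ub]].
    rewrite rl ltnn eqxx ltnSn; split=> // c T' rc cm.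
    by have := leq_trans rc cm; rewrite rl ltnn.
  rewrite rl ltnW //; split=> // c T' rc cm.
  rewrite step_at_cons; case: ltnP => [cl|lc]; first exact: ub.
  by case: eqP.
case; rewrite ltnS leq_eqVlt => /orP[->//|rl].
rewrite rl => e ub; apply/orP; right; apply/IH; split=> //.
by apply/(unblocked_cons None) => // c T rc cl; apply: ub => //; apply: ltnW.
Qed.

(** Unrolls the recursion into one condition per column, to be matched with the conditions on a
    tableau. *)
Lemma validP l : size l <= N ->
  valid l <-> forall c T, step_at l c = Some T ->
    T != set0 /\
    forall r, r \in T -> [/\ r < c, step_at l r = None & unblocked l r c].
Proof.
elim: l => [|x l IH] sN.
  by split=> // _ c T; rewrite /step_at nth_nil.
have {}IH := IH (ltnW sN).
(* The condition on a column involves only earlier steps, so a new latest step does not affect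
   it. *)
have restr c T : c < size l ->
   (forall r, r \in T -> [/\ r < c, step_at l r = None & unblocked l r c]) <->
   (forall r, r \in T -> [/\ r < c, step_at (x :: l) r = None & unblocked (x :: l) r c]).
  move=> cl; split=> H r /H [rc e ub]; split=> //.
  - by rewrite step_at_cons (ltn_trans rc cl).
  - exact/unblocked_cons/ub/ltnW.
  - by move: e; rewrite step_at_cons (ltn_trans rc cl).
  - exact/(unblocked_cons x)/ub/ltnW.
have tail : (forall c T, step_at (x :: l) c = Some T -> T != set0 /\
    forall r, r \in T -> [/\ r < c, step_at (x :: l) r = None & unblocked (x :: l) r c])
   -> valid l.
  move=> H; apply/IH => c T e.
  have cl : c < size l.
    by rewrite ltnNge; apply/negP => lc; move: e; rewrite /step_at nth_default // size_rev.
  have [|n0 H'] := H c T; first by rewrite step_at_cons cl.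
  by split=> //; apply/restr.
have step_lt c T : step_at (x :: l) c = Some T ->
    (c < size l /\ step_at l c = Some T) \/ (c = size l :> nat /\ x = Some T).
  rewrite step_at_cons; case: ltnP => // lc; first by left.
  by case: eqP => // -> ->; right.
split.
  move=> vx; have vl : valid l by case: (x) vx => [T /and3P[]|].
  move=> c T /step_lt[[cl e]|[cl ex]].
    have [n0 H] := IH.1 vl c T e; split=> //; exact/restr.
  move: vx; rewrite ex => /and3P[/subsetP sT n0 _]; split=> // r /sT.
  move/(unrestrictedP _ (ltnW sN)) => [rl e ub]; rewrite cl; split=> //.
    by rewrite step_at_cons rl.
  exact/unblocked_cons.
move=> H; have vl := tail H.
case ex: x => [T|//] /=; rewrite vl andbT.
have [|n0 H'] := H (Ordinal sN) T; first by rewrite step_at_cons /= ltnn eqxx.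
rewrite n0 andbT; apply/subsetP => r /H'[/= rl e ub].
apply/unrestrictedP; first exact: ltnW.
split=> //; first by move: e; rewrite step_at_cons rl.
exact/(unblocked_cons x).
Qed.

Lemma history_cornersE l : history_corners l =
  \sum_(t < size l)
    [&& 0 < t, step_at l t.-1 == None & step_at l t != None].
Proof.
elim: l => [|x l IH]; first by rewrite big_ord0.
rewrite /= big_ord_recr /= {}IH addnC; congr (_ + _).
  apply: eq_bigr => t _; rewrite !step_at_cons ltn_ord.
  by rewrite (leq_ltn_trans (leq_pred t) (ltn_ord t)).
rewrite !step_at_cons ltnn eqxx; case: l => [|y l] /=; first by rewrite andNb.
by rewrite ltnSn step_at_cons ltnn eqxx andbC.
Qed.

End Steps.

(** * From a filled diagram to its history *)

Section Encoding.
Variables (k n : nat) (D : diagram k n).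
Hypothesis kn : k <= n.
Variable F : filling D.
Local Notation rows := (row_labels D kn).
Local Notation row_label := (row_label D kn).
Local Notation col_label := (col_label D kn).

Definition ones (t : 'I_n) : {set 'I_n} :=
  [set r | [exists c : cell D,
     [&& row_label (cell_row c) == r, col_label (cell_col c) == t & F c]]].

Definition history : seq (option {set 'I_n}) :=
  rev [seq if t \in rows then None else Some (ones t) | t <- enum 'I_n].

Lemma size_history : size history = n.
Proof. by rewrite size_rev size_map size_enum_ord. Qed.

Lemma step_at_history (t : 'I_n) :
  step_at history t = if t \in rows then None else Some (ones t).
Proof.
rewrite /step_at revK (nth_map t) ?size_enum_ord //.
by rewrite nth_ord_enum.
Qed.

Lemma onesP (t r : 'I_n) :
  reflect (exists2 c : cell D,
    row_label (cell_row c) = r /\ col_label (cell_col c) = t & F c)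
    (r \in ones t).
Proof.
rewrite inE; apply: (iffP existsP) => [[c /and3P[/eqP ? /eqP ? ?]]|[c [? ?] Fc]].
  by exists c.
by exists c; apply/and3P; split=> //; apply/eqP.
Qed.

Lemma mem_ones_cell (c : cell D) :
  (row_label (cell_row c) \in ones (col_label (cell_col c))) = F c.
Proof.
apply/onesP/idP => [[c' [/row_label_inj er /col_label_inj ec]]|Fc]; last by exists c.
by rewrite (cell_inj er ec).
Qed.

(** Columns further left come later on the border. Validity lets a column have a 1 only in rows
    still unrestricted by the columns to its right, which is the absence of a 0 with a 1 above and a
    1 to the left. *)
Lemma valid_history : valid history = is_permutation_tableau F.
Proof.
have step_col j : step_at history (col_label j) = Some (ones (col_label j)).
  by rewrite step_at_history (negbTE (col_label_notin_rows _ _ _)).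
have step_row i : step_at history (row_label i) = None.
  by rewrite step_at_history row_label_in_rows.
have step_Some (t : 'I_n) T : step_at history t = Some T ->
    exists2 j, t = col_label j & T = ones t.
  rewrite step_at_history; case: ifPn => // /notin_rows[j tj] [<-].
  by exists j.
have sz : size history <= n by rewrite size_history.
apply/idP/idP => [/(validP sz) V | /and3P[_ /forallP one /existsPn noz]].
  have one : column_has_one F.
    apply/forallP => j; have [/set0Pn[r /onesP[c [_ ec] Fc]] _] := V _ _ (step_col j).
    by apply/existsP; exists c; rewrite Fc andbT (col_label_inj ec).
  rewrite /is_permutation_tableau one /=; apply/andP; split.
    apply/forallP => j; have /existsP[c /andP[cj _]] := forallP one j.
    by apply/existsP; exists c.
  apply/existsPn => c; apply/and3P => -[nFc].
  case/existsP=> u /and3P[/eqP uc ur Fu] /existsP[l /and3P[/eqP lr lc Fl]].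
  (* The 1 at [l] needs its row unblocked by earlier columns, but the 0 at [c] below the 1 at [u]
     blocks it. *)
  have [_ H] := V _ _ (step_col (cell_col l)).
  have [|_ _ ub] := H (row_label (cell_row l)); first by rewrite mem_ones_cell.
  have := ub (col_label (cell_col c)) _ _ _ (step_col _).
  rewrite lr col_label_ltn lc mem_ones_cell (negbTE nFc) => -[||//|];
    [exact: cell_labels | by [] |].
  move/(_ (row_label (cell_row u))); rewrite -{1}uc mem_ones_cell => /(_ Fu).
  by rewrite leqNgt row_label_ltn ur.
apply/validP => // t T /step_Some[j tj ->]; split.
  have /existsP[c /andP[/eqP cj Fc]] := one j.
  by apply/set0Pn; exists (row_label (cell_row c)); apply/onesP; exists c; rewrite ?cj.
move=> r /onesP[c [<- ct] Fc]; split.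
- by rewrite -ct cell_labels.
- exact: step_row.
move=> t' T' rt' t't /step_Some[j' tj' ->].
have rj' : row_label (cell_row c) < col_label j' by rewrite -tj'.
have [c' [c'r c'c]] := cell_of_labels rj'.
rewrite -c'r tj' -c'c mem_ones_cell; case Fc': (F c'); [by left|right].
move=> s /onesP[u [<- uc] Fu]; rewrite leqNgt; apply/negP; rewrite row_label_ltn => ur.
(* Otherwise the 0 at [c'] has the 1 of [u] above it and the 1 of [c] to its left. *)
apply: (negP (noz c')); rewrite Fc' /=; apply/andP; split; apply/existsP.
  by exists u; rewrite (col_label_inj uc) eqxx ur Fu.
exists c; rewrite c'r eqxx Fc andbT /=.
by rewrite -(col_label_ltn D kn) ct c'c -tj'.
Qed.

Lemma history_corners_history : history_corners history = nb_corners D.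
Proof.
rewrite history_cornersE nb_cornersE size_history; apply: eq_bigr => t _.
rewrite step_at_history; case: (boolP (t \in rows)) => _; first by rewrite !andbF.
rewrite andbT /=; congr (nat_of_bool _); apply/andP/exists_inP => [[t0]|[r rr /eqP e]].
  have t1n : t.-1 < n by apply: leq_ltn_trans (leq_pred t) _.
  rewrite (step_at_history (Ordinal t1n)); case: ifP => // H _.
  by exists (Ordinal t1n) => //=; rewrite prednK.
by rewrite e /= step_at_history rr.
Qed.

End Encoding.

(** * Bijection between tableaux and valid histories *)

Section Bijection.
Variable n : nat.

Definition history_of (P : filled_diagram n) : seq (option {set 'I_n}) :=
  history (leq_ord (tag P)) (entries P).

(** The positions of [None] give the row labels, hence the diagram; the sets at the other positions
    give the entries. *)
Lemma history_of_inj : injective history_of.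
Proof.
move=> [k [D F]] [k' [D' F']]; rewrite /history_of /entries /underlying /= => e.
have eR : row_labels D (leq_ord k) = row_labels D' (leq_ord k').
  apply/setP => t; have := congr1 (fun l => step_at l t) e.
  by rewrite !step_at_history; do 2 case: ifP.
have ek : k = k'.
  by apply/val_inj; rewrite /= -(card_row_labels D (leq_ord k)) eR card_row_labels.
subst k'; have eD := row_labels_inj eR; subst D'.
suff -> : F = F' by []; apply/ffunP => c.
have := congr1 (fun l => step_at l (col_label D (leq_ord k) (cell_col c))) e.
rewrite !step_at_history (negbTE (col_label_notin_rows _ _ _)) => -[].
by move/setP/(_ (row_label D (leq_ord k) (cell_row c))); rewrite !mem_ones_cell.
Qed.

(** The positions of [None] define the diagram and the sets define the filling. By validity each set
    contains only rows with earlier labels, so each of its elements corresponds to a cell. *)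
Lemma history_of_surj (l : seq (option {set 'I_n})) :
  size l = n -> valid l -> exists P, history_of P = l.
Proof.
move=> sz v; pose A := [set t : 'I_n | step_at l t == None].
have kn : #|A| < n.+1 by rewrite ltnS -[X in _ <= X]card_ord max_card.
pose kA : #|A| <= n := leq_ord (Ordinal kn).
have [D DA] := row_labels_surj kA.
pose F : filling D := [ffun c => row_label D kA (cell_row c) \in
  odflt set0 (step_at l (col_label D kA (cell_col c)))].
exists (existT _ (Ordinal kn) (existT _ D F)).
apply: (can_inj revK); apply: (@eq_from_nth _ None).
  by rewrite 2!size_rev /history_of size_history sz.
rewrite size_rev /history_of size_history => t tn.
have /= := step_at_history kA F (Ordinal tn).
rewrite /step_at => ->; rewrite -/(step_at l t) DA inE /=.
case e: (step_at l t) => [T|] //=; congr Some; apply/setP => r.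
have [|_ H] := (validP _).1 v (Ordinal tn) T e; first by rewrite sz.
have [j tj] : exists j, Ordinal tn = col_label D kA j.
  by apply: notin_rows; rewrite DA inE /= e.
apply/onesP/idP => [[c [<- ec]]|rT].
  by rewrite ffunE ec /= e.
have [rt rN _] := H r rT.
have /imsetP[i _ ri] : r \in row_labels D kA by rewrite DA inE rN.
have [|c [ci cj]] := @cell_of_labels _ _ D kA i j; first by rewrite -ri -tj.
by exists c; rewrite ?ffunE ci cj -?ri -?tj //= e.
Qed.

Lemma total_cornersE :
  total_corners n = \sum_(l <- histories n n) history_corners l.
Proof.
have -> : total_corners n =
    \sum_(l <- map history_of (enum (permutation_tableaux n))) history_corners l.
  rewrite big_map big_enum; apply: eq_bigr => P _.
  by rewrite history_corners_history.
apply: perm_big; apply: uniq_perm.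
- by rewrite (map_inj_uniq history_of_inj) enum_uniq.
- exact: histories_uniq.
move=> l; rewrite mem_histories; apply/mapP/andP => [[P]|[/eqP sz v]].
  by rewrite mem_enum inE -(valid_history (leq_ord (tag P))) => v ->; rewrite size_history.
have [P eP] := history_of_surj sz v; exists P => //.
by rewrite mem_enum inE -(valid_history (leq_ord (tag P))) -/(history_of P) eP.
Qed.

End Bijection.

(** * Solution of the recurrence and evaluation *)

Import GRing.Theory.
Local Open Scope ring_scope.

(** Dividing by the product leaves [q_t(y)] with [q_0(y) = y] and [q_(t+1)(y) = q_t(y + 1) + (t + 2)
    y + (t + 1)]. So [q_t] is linear in [y], with slope [binom(t+2, 2)] and constant term
    [binom(t+2, 3) + binom(t+1, 2)]. *)
Lemma corner_gfE N t (y : rat) : (t.+1 < N)%N ->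
  corner_gf N t.+2 y = \prod_(i < t) (y + i%:R) *
    (y * (t%:R + 1) * (t%:R + 2) / 2 + t%:R * (t%:R + 1) * (t%:R + 2) / 6
     + t%:R * (t%:R + 1) / 2).
Proof.
elim: t y => [|t IH] y tN.
  by rewrite corner_gfSS // corner_gf1 !history_gfE // !big_ord0; field.
rewrite corner_gfSS // IH; last exact: ltnW.
rewrite !history_gfE; [|by rewrite ltnW // ltnW..].
(* The shift identities [E] and [E'] make every term a multiple of
   [\prod_(i < t) (y + 1 + i%:R)]. *)
have E : \prod_(i < t.+1) (y + i%:R) = y * \prod_(i < t) (y + 1 + i%:R).
  rewrite big_ord_recl addr0; congr (_ * _).
  by apply: eq_bigr => i _; rewrite -addrA -natr1 [1 + _]addrC.
have E' : y * \prod_(i < t.+1) (y + 1 + i%:R) =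
   (\prod_(i < t.+1) (y + i%:R)) * (y + t%:R + 1).
  by rewrite E big_ord_recr /=; ring.
rewrite mulrBr [y * ((y + 1) * _)]mulrCA E' -natr1 E.
by field.
Qed.

Theorem theorem2p5 (n : nat) (n_gt0 : (0 < n)%N) :
  (total_corners n)%:R =
    (if n == 1%N then 0
     else (n - 1)`!%:R * ((n%:R ^+ 2 + 4 * n%:R - 6) / 6)) :> rat.
Proof.
have -> : (total_corners n)%:R = corner_gf n n (1 : rat).
  rewrite total_cornersE natr_sum; apply: eq_bigr => l _.
  by rewrite expr1n mulr1.
case: n n_gt0 => [|[|t]] // _; first exact: corner_gf1.
(* With [n = t + 2] and [y = 1] the second factor is [(t + 1) (t^2 + 8 t + 6) / 6], and
   [t^2 + 8 t + 6 = n^2 + 4 n - 6]. *)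
rewrite corner_gfE // subn1 /= factS natrM -!natr1.
have -> : \prod_(i < t) (1 + i%:R) = t`!%:R :> rat.
  rewrite fact_prod natr_prod big_add1 big_mkord; apply: eq_bigr => i _.
  by rewrite -natr1 addrC.
by field.
Qed.
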